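(* Let $R$ be a finite chain ring with residue field of cardinality $p^r$ ($p$ prime) and maximal ideal of nilpotency index $s$, and let $0<k<n$ be integers. (i) If $\gcd(n,k)=1$, then there are $p^{r(s-1)}(p^r-1)$ $n$-equivalence classes on $B_k$. (ii) If $\gcd(n,p)=1$ or $\gcd(k,p)=1$, then there are $p^{r(s-1)}(p^r-1)\gcd(n,k,p^r-1)$ $n$-equivalence classes on $B_k$. (iii) In particular, when $\gcd(n,p)=1$, the number of $n$-equivalence classes on $B$ is $p^{r(s-1)}(p^r-1)\sum_{k=1}^{n-1}\gcd(n,k,p^r-1)$.
   Context: A finite chain ring $R$ is a finite commutative local ring with identity whose ideals are linearly ordered by inclusion; $R^\times$ is its group of units. For $0<k<n$, $B_k=\{b_1x^k+b_0\mid b_1,b_0\in R^\times\}\subset R[x]$, and $B=\bigsqcup_{0<k<n}B_k$. Two elements $a(x),b(x)\in B$ are $n$-equivalent if there exists $\alpha\in R^\times$ such that $f(x)\mapsto f(\alpha x)$ is a (well-defined) $R$-algebra isomorphism $R[x]/\langle x^n-a(x)\rangle\to R[x]/\langle x^n-b(x)\rangle$; this is an equivalence relation on $B$, and it restricts to an equivalence relation on each $B_k$. *)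

(* Defs.v *)
From HB Require Import structures.
From mathcomp Require Import all_boot all_order all_algebra.
From mathcomp Require Import mathcomp_extra boolp classical_sets functions.
From mathcomp Require Import cardinality.

Set Implicit Arguments.
Unset Strict Implicit.
Unset Printing Implicit Defensive.

Import GRing.Theory.
Local Open Scope ring_scope.

Section FiniteChainRing.
Variable R : finComUnitRingType.

(* The whole ring is allowed here, unlike in idealr of ring_quotient. *)
Definition ideal (I : {set R}) : bool :=
  [&& 0 \in I,
      [forall x in I, forall y in I, x + y \in I]
    & [forall a : R, forall x in I, a * x \in I]].

Definition ideal_gen (A : {set R}) : {set R} :=
  \bigcap_(I : {set R} | ideal I && (A \subset I)) I.

Definition ideal_mul (I J : {set R}) : {set R} :=
  ideal_gen [set x * y | x in I, y in J]%SET.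

Definition ideal_exp (I : {set R}) (m : nat) : {set R} :=
  iter m (ideal_mul I) [set: R]%SET.

Definition maximal_ideal (M : {set R}) : Prop :=
  [/\ ideal M, M <> [set: R]%SET
    & forall I : {set R}, ideal I -> M \subset I -> I = M \/ I = [set: R]%SET].

(* The least m with I ^ m = 0; it is 1 when R is a field and I = 0. *)
Definition nilpotency_index (I : {set R}) (m : nat) : Prop :=
  ideal_exp I m = [set 0]%SET /\
  forall j : nat, (j < m)%N -> ideal_exp I j <> [set 0]%SET.

(* The underlying set of R / I, as a set of cosets x + I. *)
Definition cosets (I : {set R}) : {set {set R}} :=
  [set [set x + y | y in I] | x in [set: R]]%SET.

End FiniteChainRing.

Definition local_ring (R : finComUnitRingType) : Prop :=
  exists! M : {set R}, maximal_ideal M.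

Definition finite_chain_ring (R : finComUnitRingType) : Prop :=
  local_ring R /\
  forall I J : {set R}, ideal I -> ideal J -> I \subset J \/ J \subset I.

Section Equivalence.
Variable R : finComUnitRingType.
Local Open Scope classical_set_scope.

Definition binomials (k : nat) : set {poly R} :=
  [set a | exists b1 b0 : R, [/\ b1 \is a GRing.unit, b0 \is a GRing.unit
                               & a = b1 *: 'X^k + b0%:P]].

Definition all_binomials (n : nat) : set {poly R} :=
  \bigcup_(k in [set k | (0 < k < n)%N]) binomials k.

(* {poly %/ h} is R[x]/<h> only for h monic of positive degree (it falls back
   to R[x]/<x> otherwise); 'X^n - a is such for all a in all_binomials n. *)
Definition n_equiv (n : nat) (a b : {poly R}) : Prop :=
  exists2 alpha : R, alpha \is a GRing.unit &
  exists phi : {lrmorphism {poly %/ 'X^n - a} -> {poly %/ 'X^n - b}},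
    bijective phi /\
    forall f : {poly R},
      phi (in_qpoly ('X^n - a) f) = in_qpoly ('X^n - b) (f \Po (alpha *: 'X)).

Definition n_classes (n : nat) (A : set {poly R}) : set (set {poly R}) :=
  [set [set b | A b /\ n_equiv n a b] | a in A].

End Equivalence.

Arguments binomials R k : clear implicits.
Arguments all_binomials R n : clear implicits.

(* Main.v *)
Require Import Defs.
From HB Require Import structures.
From mathcomp Require Import all_boot all_order all_algebra.
From mathcomp Require Import all_fingroup all_solvable.
From mathcomp Require Import mathcomp_extra boolp classical_sets functions.
From mathcomp Require Import cardinality.

(* x |-> al x carries x^n - a(x) to a unit multiple of x^n - b(x) exactly when
   a(al x) = al^n b(x).  For binomials this forces the same k and says that the
   coefficient pairs differ by (al^(n-k), al^n), so the n-classes on B_k are the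
   cosets in U * U of the image of U = R^* under al |-> (al^(n-k), al^n); there are
   |U| #{al | al^gcd(n,k) = 1} of them.  Since M = (g), each quotient
   (g^i)/(g^(i+1)) has q = p^r elements, whence |U| = q^(s-1) (q - 1).  When p does
   not divide d, the d-torsion of U lies in its p'-part, which has order q - 1
   because 1 + M is a p-group of order q^(s-1), and which is cyclic because it
   consists of elements that are distinct modulo M; hence it has gcd(d, q - 1)
   elements. *)

Set Implicit Arguments.
Unset Strict Implicit.

(** * Torsion in finite abelian groups and the index of a power map *)

Section Groups.
Local Open Scope group_scope.

(** In a cyclic group, inclusion of subgroups amounts to divisibility of their orders. So, with [e]
    the gcd, [x] is [d]-torsion exactly when its order divides [e], that is, when [x] lies in the
    subgroup of order [e], generated by [a ^+ (#[a] %/ e)]. *)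
Lemma card_torsion_cyclic (gT : finGroupType) (H : {group gT}) d :
  cyclic H -> #|[set x in H | x ^+ d == 1]| = gcdn d #|H|.
Proof.
move=> cH; have [a Ha] := cyclicP cH.
set e := gcdn d #|H|; have e_dvd : e %| #[a] by rewrite /e Ha dvdn_gcdr.
have sK : <[a ^+ (#[a] %/ e)]> \subset H by rewrite Ha cycleX.
have oK : #|<[a ^+ (#[a] %/ e)]>| = e.
  by rewrite -orderE orderXdiv ?dvdn_div // divnA // mulKn ?order_gt0.
rewrite -[RHS]oK; apply: eq_card => x; rewrite !inE -order_dvdn.
have [Hx|nHx] /= := boolP (x \in H); last first.
  by apply/esym/negP=> /(fintype.subsetP sK); apply/negP.
rewrite -cycle_subG -(cardSg_cyclic cH) ?cycle_subG // -?cycle_subG //.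
by rewrite /= oK dvdn_gcd -orderE order_dvdG // andbT.
Qed.

(** The order of a [d]-torsion element divides [d], hence is prime to [p]; in an abelian group the
    [p']-core is a normal Hall subgroup and so contains every such element. *)
Lemma card_torsion_coprime (gT : finGroupType) (G : {group gT}) (p d : nat) :
    prime p -> abelian G -> coprime d p ->
  #|[set x in G | x ^+ d == 1]| = #|[set x in 'O_p^'(G) | x ^+ d == 1]|.
Proof.
move=> p_pr cG co_dp; apply: eq_card => x; rewrite !inE.
have [/eqP xd|] := boolP (x ^+ d == 1); rewrite ?andbF ?andbT //.
have hallG := nilpotent_pcore_Hall p^' (abelian_nil cG).
case Gx: (x \in G); last first.
  by apply/esym; apply: contraFF Gx; apply: (fintype.subsetP (pcore_sub _ _)).
rewrite (mem_normal_Hall hallG (pcore_normal _ _) Gx) /p_elt.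
apply/esym; apply: (@pnat_dvd _ d); first by rewrite order_dvdn; apply/eqP.
by rewrite p'natE // -prime_coprime // coprime_sym.
Qed.

Definition power_pair (gT : finGroupType) (m n : nat) (u : gT) : gT * gT :=
  (u ^+ m, u ^+ n).

Lemma power_pair_morph (gT : finGroupType) (m n : nat) :
    abelian [set: gT] ->
  {in [set: gT] &, {morph @power_pair gT m n : x y / x * y}}.
Proof.
move=> /centsP cT x y _ _; have cxy : commute x y by apply: cT.
by rewrite /power_pair !expgMn.
Qed.

Lemma power_pair_group_set (gT : finGroupType) (m n : nat) :
  abelian [set: gT] -> group_set (power_pair m n @: [set: gT]).
Proof.
move=> abT; rewrite -[_ @: _](morphimEdom (Morphism (power_pair_morph m n abT))).
exact: groupP.
Qed.

(** The kernel of u |-> (u^m, u^n) is the gcd(m,n)-torsion, and |image| |kernel| = |U|. Cancelling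
    |image| in |image| index = |U|^2 = |image| |kernel| |U| leaves index = |U| |kernel|. *)
Lemma card_cosets_power_pair (gT : finGroupType) (m n : nat) :
    abelian [set: gT] ->
  #|rcosets (power_pair m n @: [set: gT]) [set: gT * gT]|
    = (#|gT| * #|[set u : gT | u ^+ gcdn m n == 1%g]|)%N.
Proof.
move=> abT; pose f := Morphism (power_pair_morph m n abT).
have <- : f @* [set: gT] = power_pair m n @: [set: gT] by rewrite morphimEdom.
have kerE : 'ker f = [set u : gT | u ^+ gcdn m n == 1].
  apply/setP=> u; rewrite !inE -order_dvdn dvdn_gcd !order_dvdn.
  by [].
have cardX : (#|gT| * #|gT|)%N = #|[set: gT * gT]| by rewrite cardsT card_prod.
have im_ker : (#|f @* [set: gT]| * #|'ker f|)%N = #|gT|.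
  by rewrite card_morphim finset.setTI mulnC Lagrange ?finset.subsetT // cardsT.
rewrite -kerE; have := Lagrange (finset.subsetT (f @* [set: gT])%G).
rewrite -[in RHS]cardX -im_ker /= -mulnA => /eqP.
rewrite eqn_pmul2l ?cardG_gt0 // => /eqP idx.
by apply: etrans idx _; rewrite im_ker mulnC.
Qed.
End Groups.

(** * Ideals of a finite ring; principal ideals and their powers *)

Section Ideals.
Import GRing.Theory.
Local Open Scope ring_scope.
Variable R : finComUnitRingType.
Implicit Types (I J M : {set R}) (a b x y : R).

Lemma ideal0 I : ideal I -> 0 \in I.
Proof. by case/and3P. Qed.

Lemma idealD I x y : ideal I -> x \in I -> y \in I -> x + y \in I.
Proof. by case/and3P=> _ /forall_inP ID _ /ID/forall_inP; apply. Qed.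

Lemma idealMl I a x : ideal I -> x \in I -> a * x \in I.
Proof. by case/and3P=> _ _ /forallP/(_ a)/forall_inP; apply. Qed.

Lemma idealMr I a x : ideal I -> x \in I -> x * a \in I.
Proof. by rewrite mulrC; apply: idealMl. Qed.

Lemma ideal_group_set I : ideal I -> group_set I.
Proof.
move=> idI; apply/group_setP; split; first exact: ideal0.
by move=> x y; apply: idealD.
Qed.

Lemma ideal_unit I x : ideal I -> x \in I -> x \is a GRing.unit -> I = [set: R]%SET.
Proof.
move=> idI Ix Ux; apply/setP=> y; rewrite inE.
by rewrite -(divrK Ux y) idealMl.
Qed.

Definition principal a : {set R} := [set x * a | x in [set: R]]%SET.

Lemma principalP a y : reflect (exists x, y = x * a) (y \in principal a).
Proof.
by apply: (iffP imsetP) => [[x _ ->]|[x ->]]; exists x.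
Qed.

Lemma principal_ideal a : ideal (principal a).
Proof.
apply/and3P; split; first by apply/principalP; exists 0; rewrite mul0r.
- apply/forall_inP=> _ /principalP[x ->]; apply/forall_inP=> _ /principalP[y ->].
  by apply/principalP; exists (x + y); rewrite mulrDl.
apply/forallP=> b; apply/forall_inP=> _ /principalP[x ->].
by apply/principalP; exists (b * x); rewrite mulrA.
Qed.

Lemma principal_id a : a \in principal a.
Proof. by apply/principalP; exists 1; rewrite mul1r. Qed.

Lemma principal_sub I a : ideal I -> (principal a \subset I) = (a \in I).
Proof.
move=> idI; apply/fintype.subsetP/idP=> [|Ia _ /principalP[x ->]]; last first.
  exact: idealMl.
by apply; apply: principal_id.
Qed.

Lemma principal1 : principal 1 = [set: R]%SET.
Proof. exact: ideal_unit (principal_ideal 1) (principal_id 1) (unitr1 R). Qed.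

Lemma principal0 : principal 0 = [set 0]%SET.
Proof.
apply/setP=> y; rewrite inE; apply/principalP/eqP=> [[x ->]|->].
  by rewrite mulr0.
by exists 0; rewrite mulr0.
Qed.

Lemma ideal_mul_principal a b :
  ideal_mul (principal a) (principal b) = principal (a * b).
Proof.
apply/eqP; rewrite finset.eqEsubset; apply/andP; split.
  apply: finset.bigcap_inf; rewrite principal_ideal /=.
  apply/fintype.subsetP=> _ /imset2P[_ _ /principalP[x ->] /principalP[y ->] ->].
  by apply/principalP; exists (x * y); rewrite mulrACA.
apply/finset.bigcapsP=> I /andP[idI /fintype.subsetP sI]; rewrite principal_sub //.
by apply/sI/imset2P; exists a b; rewrite ?principal_id.
Qed.

Lemma ideal_exp_principal a m : ideal_exp (principal a) m = principal (a ^+ m).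
Proof.
elim: m => [|m IHm]; first by rewrite expr0 principal1.
by rewrite exprS -ideal_mul_principal -IHm.
Qed.

Definition annihilator a : {set R} := [set x | x * a == 0]%SET.

(** First isomorphism theorem for multiplication by [a], an additive map on [I] whose kernel is the
    whole annihilator because [I] contains it. *)
Lemma card_mulr_ideal I a : ideal I -> annihilator a \subset I ->
  (#|annihilator a| * #|[set (x * a)%R | x in I]%SET|)%N = #|I|.
Proof.
move=> idI sI.
have fM : {in [set: R]%SET &, {morph *%R^~ a : x y / (x * y)%g}}.
  by move=> x y _ _; apply: mulrDl.
pose f := Morphism fM; pose G := Group (ideal_group_set idI).
have kerE : ('ker f)%g = annihilator a.
  by apply/setP=> x; rewrite !inE.
have := card_morphim f G; rewrite morphimE !finset.setTI => ->.
by rewrite kerE -[RHS](@Lagrange _ G ('ker f)%G) /= ?kerE.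
Qed.

Lemma card_ideal_cosets I : ideal I -> (#|I| * #|cosets I|)%N = #|R|.
Proof.
move=> idI; pose G := Group (ideal_group_set idI).
have := @Lagrange _ [set: R]%G G (finset.subsetT _).
by rewrite -card_lcosets cardsT.
Qed.

(** * Finite chain rings: cardinalities and the structure of the unit group *)

Section ChainRing.
Variable M : {set R}.
Hypotheses (R_chain : finite_chain_ring R) (M_max : maximal_ideal M).

(** A nonunit generates a proper ideal, which is comparable with [M]; if it contains [M], maximality
    makes it equal to [M]. Either way [x] lies in [M]. *)
Lemma unitr_max_ideal x : (x \is a GRing.unit) = (x \notin M).
Proof.
have [idM M'T maxM] := M_max; have [_ chain] := R_chain.
apply/idP/idP=> [Ux|]; first by apply/negP=> Mx; apply/M'T/(ideal_unit idM Mx).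
apply: contraNT=> nUx.
have xP : principal x <> [set: R]%SET.
  move=> xT; have /principalP[y y1] : 1 \in principal x by rewrite xT inE.
  by case/negP: nUx; apply/unitrP; exists y; rewrite [(x * y)%R]mulrC -y1.
have [|sM] := chain _ _ (principal_ideal x) idM.
  by rewrite principal_sub.
by have [<-|] := maxM _ (principal_ideal x) sM; first exact: principal_id.
Qed.

(** Choose [g] in [M] generating the largest principal ideal. Any other [y] in [M] generates a
    comparable ideal, which by this choice cannot be strictly larger. *)
Lemma max_ideal_principal : {g | M = principal g}.
Proof.
have [idM _ _] := M_max; have [_ chain] := R_chain.
case: (@arg_maxnP _ 0 [in M] (fun x => #|principal x|)) => [|g Mg g_max].
  exact: ideal0.
exists g; apply/eqP; rewrite finset.eqEsubset principal_sub // andbC Mg.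
apply/fintype.subsetP=> y My.
have [|sgy] := chain _ _ (principal_ideal y) (principal_ideal g).
  by rewrite principal_sub //; apply: principal_ideal.
have /eqP-> : principal g == principal y by rewrite eqEcard sgy; apply: g_max.
exact: principal_id.
Qed.

Variable s : nat.
Hypothesis M_nilp : nilpotency_index M s.

Lemma nilpotency_index_gt0 : (0 < s)%N.
Proof.
case: s M_nilp => // -[/setP/(_ 1)]; rewrite !inE => /esym/eqP/eqP.
by rewrite oner_eq0.
Qed.

(* Multiplication by g ^ i maps R onto (g ^ i) and M onto (g ^ (i + 1)) with the
   same kernel, which lies in M as g ^ i <> 0. *)
Lemma card_principal_step g i : M = principal g -> (i < s)%N ->
  #|principal (g ^+ i)| = (#|cosets M| * #|principal (g ^+ i.+1)|)%N.
Proof.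
have [idM _ _] := M_max => Mg lt_is.
have gi_neq0 : g ^+ i != 0.
  case: M_nilp => _ /(_ i lt_is); rewrite Mg ideal_exp_principal => gi.
  by apply/eqP=> gi0; apply: gi; rewrite gi0 principal0.
have ann_sub : annihilator (g ^+ i) \subset M.
  apply/fintype.subsetP=> x; rewrite inE; apply: contraTT.
  by rewrite -unitr_max_ideal => Ux; rewrite mulrI_eq0 //; apply: mulrI.
have imM : [set x * g ^+ i | x in M]%SET = principal (g ^+ i.+1).
  apply/setP=> y; apply/imsetP/principalP=> [[x]|[x ->]].
    by rewrite {1}Mg => /principalP[z ->] ->; exists z; rewrite exprS mulrA.
  by exists (x * g); rewrite ?exprS ?mulrA // Mg; apply/principalP; exists x.
have cM := card_mulr_ideal idM ann_sub.
have := card_ideal_cosets idM; rewrite -cM imM -cardsT.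
rewrite -(@card_mulr_ideal [set: R]%SET (g ^+ i)) ?finset.subsetT //; last first.
  by rewrite -principal1 principal_ideal.
rewrite -mulnA => /eqP; rewrite eqn_pmul2l; last first.
  by apply/card_gt0P; exists 0; rewrite inE mul0r.
by move/eqP=> <-; rewrite mulnC.
Qed.

(** The induction climbs from the bottom of the chain, where (g^s) = 0 has one element; each step
    multiplies the size by that of the residue field. *)
Lemma card_principal_exp g i : M = principal g -> (i <= s)%N ->
  #|principal (g ^+ (s - i))| = (#|cosets M| ^ i)%N.
Proof.
move=> Mg; elim: i => [_|i IHi lt_is].
  have [gs0 _] := M_nilp; rewrite Mg ideal_exp_principal in gs0.
  by rewrite subn0 gs0 cards1.
have lt_s : (s - i.+1 < s)%N by rewrite ltn_subrL (leq_trans _ lt_is).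
by rewrite (card_principal_step Mg lt_s) subnSK // IHi ?expnS // ltnW.
Qed.

Lemma card_chain_ring : #|R| = (#|cosets M| ^ s)%N.
Proof.
have [g Mg] := max_ideal_principal.
by rewrite -(card_principal_exp Mg (leqnn s)) subnn expr0 principal1 cardsT.
Qed.

Lemma card_max_ideal : #|M| = (#|cosets M| ^ (s - 1))%N.
Proof.
have [g Mg] := max_ideal_principal; have s_gt0 := nilpotency_index_gt0.
by rewrite -(card_principal_exp Mg (leq_subr 1 s)) subKn // expr1 -Mg.
Qed.

Lemma card_units : #|{: {unit R}}| = (#|cosets M| ^ (s - 1) * (#|cosets M| - 1))%N.
Proof.
rewrite mulnBr muln1 -expnSr subn1 prednK ?nilpotency_index_gt0 //.
rewrite -subn1 -card_max_ideal -card_chain_ring card_sub.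
rewrite -(cardC M) addKn; apply: eq_card => x.
by rewrite inE [in RHS]inE unitr_max_ideal.
Qed.

Lemma unit_group_abelian : abelian [set: {unit R}].
Proof. by apply/centsP=> u _ v _; apply: val_inj; apply: mulrC. Qed.

(** The subgroup 1 + M, the kernel of reduction from the units of [R] to those of the residue
    field. *)
Definition one_units : {set {unit R}} := [set u | val u - 1 \in M]%SET.

Lemma one_units_group_set : group_set one_units.
Proof.
have [idM _ _] := M_max; apply/group_setP; split=> [|u v].
  by rewrite inE subrr ideal0.
rewrite !inE => Mu Mv.
have -> : val (u * v)%g - 1 = (val u - 1) * val v + (val v - 1).
  by rewrite mulrBl mul1r addrA subrK.
by rewrite idealD // idealMr.
Qed.

(** Translation by 1 is the bijection: for [y] in [M] the element [y + 1] is a unit, since otherwise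
    1 = -y + (y + 1) would lie in [M]. *)
Lemma card_one_units : #|one_units| = #|M|.
Proof.
rewrite -(card_imset _ val_inj) -(card_imset M (addIr 1)).
apply: eq_card => x; apply/imsetP/imsetP=> [[u]|[y My] ->].
  by rewrite inE => Mu ->; exists (val u - 1); rewrite ?subrK.
have Uy : y + 1 \is a GRing.unit.
  rewrite unitr_max_ideal; have [idM _ _] := M_max; apply/negP=> My1.
  have : 1 \in M by rewrite -[1](addKr y) idealD // -mulN1r idealMl.
  by apply/negP; rewrite -unitr_max_ideal unitr1.
by exists (FinRing.unit R Uy); rewrite // inE /= addrK.
Qed.

Variables p r : nat.
Hypotheses (p_prime : prime p) (card_residue : #|cosets M| = (p ^ r)%N).

(** If [r] were 0, the residue field would have one element and the formula for the number of units
    would give 0. *)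
Lemma residue_exponent_gt0 : (0 < r)%N.
Proof.
have : (0 < #|{: {unit R}}|)%N by apply/card_gt0P; exists 1%g.
by rewrite card_units card_residue; case: r; rewrite // subnn muln0.
Qed.

Lemma card_unit_p'core : #|'O_p^'([set: {unit R}])%g| = (p ^ r - 1)%N.
Proof.
have /card_Hall-> := nilpotent_pcore_Hall p^' (abelian_nil unit_group_abelian).
have pr_gt1 : (1 < p ^ r)%N.
  by rewrite -(exp1n r) ltn_exp2r ?prime_gt1 ?residue_exponent_gt0.
rewrite cardsT card_units card_residue.
(* The factor q^(s-1) is a power of [p] and has trivial [p']-part; the factor q - 1 is prime to [p],
   because a common divisor [p] would divide q - (q - 1) = 1. *)
rewrite partnM ?expn_gt0 ?(prime_gt0 p_prime) ?subn_gt0 //.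
rewrite -expnM part_p'nat ?mul1n; last by rewrite pnatNK pnatX pnat_id.
rewrite part_pnat_id // p'natE //; apply/negP=> p_dvd.
have : (p %| p ^ r - (p ^ r - 1))%N.
  by rewrite dvdn_sub ?dvdn_exp ?residue_exponent_gt0.
by rewrite subKn ?(ltnW pr_gt1) // dvdn1 => /eqP p1; move: p_prime; rewrite p1.
Qed.

Lemma unit_p'core_cyclic : cyclic 'O_p^'([set: {unit R}])%g.
Proof.
(* As over a field, X^d - 1 has at most d roots with pairwise unit differences, so an abelian group
   of units is cyclic once u - 1 is a unit for each of its elements u <> 1. *)
apply: (@div_ring_mul_group_cyclic _ _ _ (fun u : {unit R} => val u)) => //;
  last first.
  exact: abelianS (finset.subsetT _) unit_group_abelian.
(* A u with u - 1 in M lies in the p-group 1 + M and in the p'-core. *)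
move=> u /setD1P[u1 Hu]; rewrite unitr_max_ideal; apply: contra u1 => Mu.
pose N := Group one_units_group_set.
have pN : p.-group%g N.
  by rewrite /pgroup card_one_units card_max_ideal card_residue -expnM pnatX pnat_id.
have /coprime_TIg/setP/(_ u) : coprime #|N| #|'O_p^'([set: {unit R}])%g|.
  exact: pnat_coprime pN (pcore_pgroup _ _).
by rewrite !inE Hu andbT Mu => /esym.
Qed.

Lemma card_unit_torsion d : coprime d p ->
  #|[set u : {unit R} | (u ^+ d == 1)%g]%SET| = gcdn d (p ^ r - 1).
Proof.
move=> co_dp; rewrite -card_unit_p'core -(card_torsion_cyclic _ unit_p'core_cyclic).
rewrite -(card_torsion_coprime p_prime unit_group_abelian co_dp).
by apply: eq_card => u; rewrite !inE.
Qed.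

End ChainRing.
End Ideals.

(** * Substitution maps between quotients and the criterion for n-equivalence *)

Section Substitution.
Import GRing.Theory.
Local Open Scope ring_scope.
Variable R : finComUnitRingType.
Implicit Types (a b f g h p q : {poly R}) (al : R).

(** Acting on the reduced representative makes the map total for all [g] and [h]; it commutes with
    the projections only when g(al x) vanishes modulo [h]. *)
Definition subst_qpoly g h al (p : {poly %/ g}) : {poly %/ h} :=
  in_qpoly h ((p : {poly R}) \Po (al *: 'X)).

Lemma in_qpoly_val h (p : {poly %/ h}) : in_qpoly h p = p.
Proof. by apply: val_inj; apply: in_qpoly_small; apply: size_mk_monic. Qed.

Lemma subst_in_qpoly g h al f :
    in_qpoly h (mk_monic g \Po (al *: 'X)) = 0 ->
  subst_qpoly h al (in_qpoly g f) = in_qpoly h (f \Po (al *: 'X)).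
Proof.
move=> gh; rewrite [in RHS](Pdiv.RingMonic.rdivp_eq (monic_mk_monic g) f).
by rewrite comp_polyD comp_polyM rmorphD rmorphM /= gh mulr0 add0r.
Qed.

Lemma comp_poly_scaleXK al be f : al * be = 1 ->
  (f \Po (al *: 'X)) \Po (be *: 'X) = f.
Proof.
move=> albe; rewrite -comp_polyA comp_polyZ comp_polyX scalerA albe scale1r.
exact: comp_polyXr.
Qed.

(** Every class is the class of its representative, so the morphism laws reduce to those of
    composition of polynomials. The condition on [be] makes the reverse substitution well defined
    too, and that is the inverse. *)
Lemma subst_qpoly_lrmorphism g h al be : al * be = 1 ->
    in_qpoly h (mk_monic g \Po (al *: 'X)) = 0 ->
    in_qpoly g (mk_monic h \Po (be *: 'X)) = 0 ->
  exists phi : {lrmorphism {poly %/ g} -> {poly %/ h}},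
    bijective phi /\
    forall f, phi (in_qpoly g f) = in_qpoly h (f \Po (al *: 'X)).
Proof.
move=> albe gh hg; pose phi := @subst_qpoly g h al.
have phiE f : phi (in_qpoly g f) = in_qpoly h (f \Po (al *: 'X)).
  exact: subst_in_qpoly.
have phi_linear : linear phi.
  move=> c p q; rewrite -(in_qpoly_val p) -(in_qpoly_val q) -linearZ -linearD.
  by rewrite !phiE comp_polyD comp_polyZ linearD linearZ.
have phi_monoid : monoid_morphism phi.
  split=> [|p q]; first by rewrite -[1](in_qpoly1 g) phiE comp_polyC in_qpoly1.
  rewrite -(in_qpoly_val p) -(in_qpoly_val q) -rmorphM.
  by rewrite !phiE comp_polyM rmorphM.
pose phiL := GRing.isSemilinear.Build R {poly %/ g} {poly %/ h} _ phi
  (GRing.semilinear_linear phi_linear).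
pose phiM := GRing.isMonoidMorphism.Build {poly %/ g} {poly %/ h} phi phi_monoid.
pose Phi : {lrmorphism {poly %/ g} -> {poly %/ h}} := HB.pack phi phiL phiM.
exists Phi; split=> //.
exists (@subst_qpoly h g be) => p; rewrite -(in_qpoly_val p) /= /phi.
  by rewrite !subst_in_qpoly // comp_poly_scaleXK.
by rewrite !subst_in_qpoly // comp_poly_scaleXK // mulrC.
Qed.

(** The bound on [a] keeps the polynomial monic of positive degree, which rules out the fallback
    value ['X] of [mk_monic]. *)
Lemma mk_monic_XnsubE n a : (0 < n)%N -> (size a <= n)%N ->
  mk_monic ('X^n - a) = 'X^n - a.
Proof.
move=> n_gt0 sa; have sza : (size (- a) < size ('X^n : {poly R}))%N.
  by rewrite size_polyN size_polyXn ltnS.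
rewrite /mk_monic size_polyDl // size_polyXn ltnS n_gt0 monicE.
by rewrite lead_coefDl // lead_coefXn eqxx.
Qed.

Lemma in_qpoly_Xnsub_id n a : (0 < n)%N -> (size a <= n)%N ->
  in_qpoly ('X^n - a) ('X^n - a) = 0.
Proof.
move=> n_gt0 sa; apply: val_inj; have := monic_mk_monic ('X^n - a).
by rewrite /= mk_monic_XnsubE //; apply: Pdiv.RingMonic.rmodpp.
Qed.

Lemma in_qpoly_XnsubE n a : (0 < n)%N -> (size a <= n)%N ->
  in_qpoly ('X^n - a) 'X^n = in_qpoly ('X^n - a) a.
Proof.
move=> n_gt0 sa; apply/eqP; rewrite -subr_eq0 -raddfB; apply/eqP.
exact: in_qpoly_Xnsub_id.
Qed.

Lemma comp_Xn_scaleX n al : 'X^n \Po (al *: 'X) = al ^+ n *: 'X^n :> {poly R}.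
Proof. by rewrite comp_Xn_poly exprZn. Qed.

(** The class of x^n - a(x) is 0, and so is its image, which says that a(al x) and al^n b(x) agree
    modulo x^n - b(x). Both have degree below n, so they are equal. *)
Lemma n_equivP n a b : (0 < n)%N -> (size a <= n)%N -> (size b <= n)%N ->
  n_equiv n a b <->
  exists2 al : R, al \is a GRing.unit & a \Po (al *: 'X) = al ^+ n *: b.
Proof.
move=> n_gt0 sa sb; split=> -[al Ual].
  case=> phi [_ phiE]; exists al => //; apply/esym/eqP; rewrite -subr_eq0.
  have := phiE ('X^n - a); rewrite in_qpoly_Xnsub_id //.
  rewrite rmorph0 comp_polyB comp_Xn_scaleX raddfB /= in_qpolyZ in_qpoly_XnsubE //.
  rewrite -in_qpolyZ -raddfB => /esym/(congr1 val) /=.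
  rewrite Pdiv.CommonRing.rmodp_small //; first by move/eqP.
  have -> : size (mk_monic ('X^n - b)) = n.+1.
    by rewrite mk_monic_XnsubE // size_polyDl ?size_polyXn // size_polyN ltnS.
  rewrite ltnS (leq_trans (size_polyD _ _)) // geq_max size_polyN.
  rewrite (leq_trans (size_scale_leq _ _)) //=.
  apply: leq_trans (size_comp_poly_leq _ _) _; rewrite -(prednK n_gt0) ltnS.
  have sX : ((size (al *: 'X)%R).-1 <= 1)%N.
    by rewrite -subn1 leq_subLR (leq_trans (size_scale_leq _ _)) ?size_polyX.
  by rewrite (leq_trans (leq_mul (leqnn _) sX)) // muln1 -!subn1 leq_sub2r.
move=> ab; exists al => //; apply: (@subst_qpoly_lrmorphism _ _ al al^-1).
- by rewrite divrr.
- rewrite mk_monic_XnsubE // comp_polyB comp_Xn_scaleX ab -scalerBr in_qpolyZ.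
  by rewrite in_qpoly_Xnsub_id // scaler0.
(* The same relation for the inverse substitution, obtained by putting al^-1 x for x in [ab]. *)
have ba : b \Po (al^-1 *: 'X) = al ^- n *: a.
  rewrite -[a](comp_poly_scaleXK _ (divrr Ual)) ab comp_polyZ scalerA.
  by rewrite mulVr ?scale1r // unitrX.
rewrite mk_monic_XnsubE // comp_polyB comp_Xn_scaleX ba exprVn -scalerBr in_qpolyZ.
by rewrite in_qpoly_Xnsub_id // scaler0.
Qed.

Lemma size_binomial n k (c1 c0 : R) : (k < n)%N ->
  (size (c1 *: 'X^k + c0%:P : {poly R})%R <= n)%N.
Proof.
move=> lt_kn; rewrite (leq_trans (size_polyD _ _)) // geq_max size_polyC.
rewrite (leq_trans (size_scale_leq _ _)) ?size_polyXn //=.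
by case: eqP => // _; apply: leq_trans lt_kn.
Qed.

Lemma coef_binomial k (c1 c0 : R) i : (c1 *: 'X^k + c0%:P : {poly R})`_i =
   c1 *+ (i == k) + c0 *+ (i == 0%N).
Proof.
by rewrite coefD coefZ coefXn coefC mulr_natr (mulrb c0).
Qed.

Lemma n_equiv_binomialP n j k (c1 c0 d1 d0 : {unit R}) :
    (0 < j < n)%N -> (0 < k < n)%N ->
  n_equiv n (val c1 *: 'X^j + (val c0)%:P) (val d1 *: 'X^k + (val d0)%:P) <->
  j = k /\ exists u : {unit R}, c1 = (u ^+ (n - k) * d1)%g /\ c0 = (u ^+ n * d0)%g.
Proof.
case/andP=> j_gt0 lt_jn /andP[k_gt0 lt_kn].
have n_gt0 : (0 < n)%N by apply: leq_trans lt_kn.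
rewrite n_equivP ?size_binomial //; split=> [[al Ual]|[-> [u [-> ->]]]].
  rewrite comp_polyD comp_polyZ comp_polyC comp_Xn_scaleX scalerA.
  rewrite scalerDr scalerA scale_polyC => /polyP ab.
  pose u := FinRing.unit R Ual.
  (* Otherwise the coefficient c1 al ^ j of X ^ j is zero, but it is a unit. *)
  have jk : j = k.
    have := ab j; rewrite !coef_binomial eqxx (gtn_eqF j_gt0) !addr0.
    case: eqP => // _ /eqP; rewrite mulr1n mulr0n => /eqP U0.
    have : val c1 * al ^+ j \is a GRing.unit by rewrite unitrM (valP c1) unitrX.
    by rewrite U0 unitr0.
  split=> //; exists u; subst j; split; apply: val_inj.
    rewrite FinRing.val_unitM FinRing.val_unitX /=.
    have := ab k; rewrite !coef_binomial eqxx (gtn_eqF k_gt0) !addr0 !mulr1n.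
    (* The coefficients of x^k give c1 al^k = al^n d1, from which the unit al^k is cancelled. *)
    rewrite -{1}(subnK (ltnW lt_kn)) exprD mulrAC => /(mulIr _); apply.
    exact: unitrX.
  have := ab 0%N; rewrite !coef_binomial eqxx (ltn_eqF k_gt0) !add0r !mulr1n.
  by rewrite FinRing.val_unitM FinRing.val_unitX.
exists (val u); first exact: valP.
rewrite comp_polyD comp_polyZ comp_polyC comp_Xn_scaleX scalerA.
rewrite !FinRing.val_unitM !FinRing.val_unitX scalerDr scalerA scale_polyC mulrAC.
by rewrite -exprD subnK // ltnW.
Qed.
End Substitution.

(** * Counting equivalence classes as cosets *)

Section Counting.
Local Open Scope classical_set_scope.

Lemma gcdn_subl k m : (k <= m)%N -> gcdn (m - k) m = gcdn m k.
Proof.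
by move/subnK; move: (m - k)%N => l <-; rewrite gcdnDl [RHS]gcdnC gcdnDr gcdnC.
Qed.

Lemma card_sum_fibers (T1 T2 : finType) (P : pred T1) (B : T1 -> {set T2}) :
  #|[set y : T1 * T2 | P y.1 & y.2 \in B y.1]%SET| = \sum_(x | P x) #|B x|.
Proof.
under [RHS]eq_bigr do rewrite -sum1_card.
by rewrite pair_big_dep -sum1_card; apply: eq_bigl => y; rewrite inE.
Qed.

(** Transfers the count from classes in [X], which need not be finite, to finite types: when [E] is
    equality of the invariant [f] of parameters, classes correspond to values of [f]. *)
Lemma card_eq_classes (T T' : finType) (X : Type) (D : {set T}) (t2x : T -> X)
    (f : T -> T') (E : X -> X -> Prop) :
    (forall t u, t \in D -> u \in D -> E (t2x t) (t2x u) <-> f t = f u) ->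
  ([set [set y | (t2x @` [set` D]) y /\ E x y] | x in t2x @` [set` D]]
     #= `I_#|(f @: D)%SET|)%card.
Proof.
move=> Ef; set A := t2x @` [set` D]; set m := #|_|.
pose C x := [set y | A y /\ E x y].
(* One parameter is chosen for each value of [f]; the chosen parameters then enumerate the classes
   without repetition. *)
have /choice[t tP] : forall i : 'I_m, exists t, t \in D /\ f t = enum_val i.
  by move=> i; have /imsetP[t Dt ->] := enum_valP i; exists t.
have Ct u v : u \in D -> v \in D -> C (t2x u) = C (t2x v) <-> f u = f v.
  move=> Du Dv; split=> [Cuv|fuv].
    apply/Ef => //; suff [] : C (t2x u) (t2x v) by [].
    by rewrite Cuv; split; [exists v | apply/Ef].
  apply/seteqP; split=> _ [[w Dw <-]] /Ef fw; split; try by exists w.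
    by apply/Ef; rewrite // -fuv fw.
  by apply/Ef; rewrite // fuv fw.
have -> : [set C x | x in A] = (fun i => C (t2x (t i))) @` [set: 'I_m].
  apply/seteqP; split=> [_ [_ [u Du <-] <-]|_ [i _ <-]].
    have fu : f u \in (f @: D)%SET by apply: imset_f.
    exists (enum_rank_in fu (f u)) => //; have [Dt ft] := tP (enum_rank_in fu (f u)).
    by apply/Ct; rewrite // ft enum_rankK_in.
  by have [Dt _] := tP i; exists (t2x (t i)) => //; exists (t i).
apply: card_eq_trans (card_esym card_II); apply: inj_card_eq => i j _ _.
have [Di fi] := tP i; have [Dj fj] := tP j.
by move/Ct => /(_ Di Dj); rewrite fi fj => /enum_val_inj.
Qed.

Variables (R : finComUnitRingType) (n : nat).
Local Open Scope ring_scope.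
Import GRing.Theory.

Definition binomial_of (t : 'I_n * ({unit R} * {unit R})) : {poly R} :=
  val t.2.1 *: 'X^(t.1) + (val t.2.2)%:P.

(** A complete invariant for positive degrees: binomials of different degrees are never equivalent,
    hence the first component, and within one degree the classes are cosets. *)
Definition orbit_of (t : 'I_n * ({unit R} * {unit R})) :
    'I_n * {set {unit R} * {unit R}} :=
  (t.1, (power_pair (n - t.1) n @: [set: {unit R}]%SET :* t.2)%g).

Lemma n_equiv_orbit_of (t u : 'I_n * ({unit R} * {unit R})) :
    (0 < t.1)%N -> (0 < u.1)%N ->
  n_equiv n (binomial_of t) (binomial_of u) <-> orbit_of t = orbit_of u.
Proof.
case: t u => [j [c1 c0]] [k [d1 d0]] /= j_gt0 k_gt0.
rewrite /binomial_of n_equiv_binomialP ?j_gt0 ?k_gt0 ?ltn_ord //=.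
have H_group := power_pair_group_set (n - k) n (unit_group_abelian R).
pose H := Group H_group.
split=> [[jk [u [-> ->]]]|].
  have -> : j = k by apply: val_inj.
  congr (_, _); apply: (@rcoset_eqP _ H); apply/rcosetP.
  exists (power_pair (n - k) n u) => //.
  exact: imset_f.
case=> -> cd; split=> //.
have /rcosetP[_ /imsetP[u _ ->] [-> ->]] : (c1, c0) \in (H :* (d1, d0))%g.
  by apply/(@rcoset_eqP _ H).
by exists u.
Qed.

(** The predicate [P] selects degrees, so that a single B_k and the whole of B are counted by one
    argument. *)
Lemma card_n_classes (P : pred nat) : (forall k, P k -> 0 < k)%N ->
  (n_classes n (\bigcup_(k in [set k | P k /\ (k < n)%N]) binomials R k)
    #= `I_(#|{: {unit R}}| * \sum_(k < n | P k)
             #|[set u : {unit R} | (u ^+ gcdn n k == 1)%g]%SET|))%card.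
Proof.
move=> P_gt0; set A := (X in n_classes n X).
pose D := [set t : 'I_n * ({unit R} * {unit R}) | P t.1]%SET.
have -> : A = binomial_of @` [set` D].
  apply/seteqP; split=> [a [k [Pk lt_kn] [b1 [b0 [Ub1 Ub0 ->]]]]|].
    exists (Ordinal lt_kn, (FinRing.unit R Ub1, FinRing.unit R Ub0)) => //.
    by rewrite /= inE.
  move=> _ [[k [b1 b0]] /= Dk <-]; rewrite inE in Dk.
  exists (val k); first by rewrite /= ltn_ord.
  by exists (val b1), (val b0); split; rewrite ?(valP b1) ?(valP b0).
pose C (k : 'I_n) :=
  rcosets (power_pair (n - k) n @: [set: {unit R}]%SET)
    [set: {unit R} * {unit R}]%SET.
(* Every coset over a selected degree is attained, so the image is a disjoint union whose size is a
   sum of indices. *)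
have imE : (orbit_of @: D)%SET = [set y | P (val y.1) & y.2 \in C y.1]%SET.
  apply/setP=> -[k c]; rewrite inE /=.
  apply/imsetP/andP=> [[[j x]]|[Pk /rcosetsP[x _ ->]]].
    by rewrite inE /= => Pj [-> ->]; split=> //; apply/rcosetsP; exists x.
  by exists (k, x); rewrite // inE.
have -> : (#|{: {unit R}}| * \sum_(k < n | P k)
             #|[set u : {unit R} | (u ^+ gcdn n k == 1)%g]%SET|)%N
    = #|(orbit_of @: D)%SET|.
  rewrite imE; apply/esym/(etrans (card_sum_fibers (fun k : 'I_n => P k) C)).
  rewrite big_distrr /=; apply: eq_bigr => k _.
  rewrite /C card_cosets_power_pair; last exact: unit_group_abelian.
  congr (_ * _)%N; apply: eq_card => u; rewrite !inE.
  by rewrite gcdn_subl // ltnW.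
apply: card_eq_classes => t u; rewrite !inE => Pt Pu.
by apply: n_equiv_orbit_of; apply: P_gt0.
Qed.
End Counting.

(** * The three counts *)

Unset Implicit Arguments.

Theorem corollary6 (R : finComUnitRingType) (M : {set R}) (p r s n k : nat)
    (R_chain : finite_chain_ring R)
    (M_max : maximal_ideal M)
    (p_prime : prime p)
    (card_residue : #|cosets M| = (p ^ r)%N)
    (M_nilp : nilpotency_index M s)
    (k_gt0 : (0 < k)%N) (k_lt_n : (k < n)%N) :
  [/\ gcdn n k = 1%N ->
        (n_classes n (binomials R k)
           #= `I_(p ^ (r * (s - 1)) * (p ^ r - 1))%N)%card,
      gcdn n p = 1%N \/ gcdn k p = 1%N ->
        (n_classes n (binomials R k)
           #= `I_(p ^ (r * (s - 1)) * (p ^ r - 1)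
                  * gcdn (gcdn n k) (p ^ r - 1))%N)%card
    & gcdn n p = 1%N ->
        (n_classes n (all_binomials R n)
           #= `I_(p ^ (r * (s - 1)) * (p ^ r - 1)
                  * \sum_(1 <= j < n) gcdn (gcdn n j) (p ^ r - 1))%N)%card].
Proof.
have cardU : #|{: {unit R}}| = (p ^ (r * (s - 1)) * (p ^ r - 1))%N.
  by rewrite (card_units R_chain M_max M_nilp) card_residue expnM.
have tors d : coprime d p ->
    #|[set u : {unit R} | (u ^+ d == 1)%g]%SET| = gcdn d (p ^ r - 1).
  exact (@card_unit_torsion R M R_chain M_max s M_nilp p r p_prime card_residue d).
have card_k : (n_classes n (binomials R k) #= `I_(#|{: {unit R}}| *
    #|[set u : {unit R} | (u ^+ gcdn n k == 1)%g]%SET|))%card.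
  have -> : binomials R k =
      (\bigcup_(j in [set j | pred1 k j /\ (j < n)%N]) binomials R j)%classic.
    rewrite -[LHS](bigcup_set1 (binomials R)); congr bigcup.
    by apply/seteqP; split=> [_ ->|j [/eqP]] //=; rewrite eqxx.
  have := @card_n_classes R n (pred1 k) _.
  rewrite (big_pred1 (Ordinal k_lt_n)) //; apply.
  by move=> _ /eqP->.
split=> [nk1|co_p|co_np].
(* For coprime n and k only the 1-torsion matters; it has gcd(1, q - 1) = 1 element, whatever [p]
   is. *)
- rewrite nk1 in card_k; rewrite -cardU -[X in `I_X]muln1.
  have -> : 1%N = #|[set u : {unit R} | (u ^+ 1 == 1)%g]%SET|.
    by rewrite tors ?gcd1n ?coprime1n.
  exact: card_k.
(* Coprimality of [p] to either n or k passes to their gcd. *)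
- rewrite -cardU -tors //; case: co_p => /eqP co_p.
    exact: coprime_dvdl (dvdn_gcdl n k) co_p.
  exact: coprime_dvdl (dvdn_gcdr n k) co_p.
have -> : all_binomials R n =
    (\bigcup_(j in [set j | (0 < j)%N /\ (j < n)%N]) binomials R j)%classic.
  by congr bigcup; apply/seteqP; split=> j /= => [/andP|[-> ->]].
have -> : (\sum_(1 <= j < n) gcdn (gcdn n j) (p ^ r - 1) =
    \sum_(j < n | 0 < j) #|[set u : {unit R} | (u ^+ gcdn n j == 1)%g]%SET|)%N.
  (* The sum starting at 1 becomes a sum from 0 filtered by 0 < j, and each term is a torsion count
     since gcd(n, j) is prime to [p]. *)
  rewrite -[RHS](big_mkord (leq 1) (fun j =>
    #|[set u : {unit R} | (u ^+ gcdn n j == 1)%g]%SET|)).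
  rewrite (big_nat_widenl 1 0) //=; apply: eq_big => [j|j _] //.
  by rewrite tors //; apply: coprime_dvdl (dvdn_gcdl n j) _; apply/eqP.
by rewrite -cardU; apply: card_n_classes.
Qed.
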